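(* Let $\rho:\mathbb{R}_+\to\mathbb{R}_+$ be a continuous, positive definite function and let $f:\mathbb{R}_+\to\mathbb{R}_+$ be a function such that either $f$ is quasi-uniformly continuous or $-f$ is quasi-uniformly continuous. Suppose that $\int_0^{+\infty}\rho(f(t))\,dt<+\infty$. Finally, suppose that either $\rho$ is non-decreasing or $f$ is bounded. Then $\lim_{t\to+\infty}f(t)=0$.
   Context: $\mathbb{R}_+=[0,+\infty)$. A function $\rho:\mathbb{R}_+\to\mathbb{R}_+$ is positive definite if $\rho(0)=0$ and $\rho(s)>0$ for $s>0$. A function $g:\mathbb{R}_+\to\mathbb{R}$ is quasi-uniformly continuous if for every $\varepsilon>0$ there exists $\delta(\varepsilon)>0$ such that $g(t)-g(t_0)<\varepsilon$ for all $t\ge t_0\ge0$ with $t\le t_0+\delta(\varepsilon)$. (Continuity is not assumed; any quasi-uniformly continuous function is Lebesgue measurable, so the integral is a Lebesgue integral.) *)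

(* Defs.v *)
From HB Require Import structures.
From mathcomp Require Import all_boot all_order all_algebra.
From mathcomp Require Import all_classical all_reals all_analysis.

Set Implicit Arguments.
Unset Strict Implicit.
Unset Printing Implicit Defensive.

Import Order.TTheory GRing.Theory Num.Theory.
Import numFieldNormedType.Exports.

Local Open Scope classical_set_scope.
Local Open Scope ring_scope.

(* A function on R_+ = [0, +oo[ is encoded as a total function on R that is
   only constrained on [0, +oo[; its values at negative points are junk. *)

Definition maps_nonneg (R : realType) (g : R -> R) : Prop :=
  forall t : R, 0 <= t -> 0 <= g t.

Definition positive_definite (R : realType) (rho : R -> R) : Prop :=
  rho 0 = 0 /\ forall s : R, 0 < s -> 0 < rho s.

Definition quasi_uniformly_continuous (R : realType) (g : R -> R) : Prop :=
  forall e : R, 0 < e -> exists2 d : R, 0 < d &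
    forall t0 t : R, 0 <= t0 -> t0 <= t -> t <= t0 + d -> g t - g t0 < e.

(* Main.v *)
Require Import Defs.
From HB Require Import structures.
From mathcomp Require Import all_boot all_order all_algebra.
From mathcomp Require Import all_classical all_reals all_analysis.
From mathcomp Require Import lra.

Set Implicit Arguments.
Unset Strict Implicit.
Unset Printing Implicit Defensive.

Import Order.TTheory GRing.Theory Num.Theory.
Import numFieldNormedType.Exports.

Local Open Scope classical_set_scope.
Local Open Scope ring_scope.

(* If f does not tend to 0, then e <= f at arbitrarily large times, and quasi
   uniform continuity of f (resp. -f) propagates e/2 <= f to a segment of fixed
   length d ending (resp. starting) at such a time.  On these segments rho o f
   is at least some c > 0, so that N disjoint ones give an integral of at least
   c * N * d, for every N. *)

(* Chebyshev's inequality, with no measurability assumed on [f]: the integral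
   of a nonnegative function is defined as a supremum over the simple functions
   below it, and [r *: \1_A] is one of them. *)
Lemma mule_measure_le_integral d (T : measurableType d) (R : realType)
    (mu : {measure set T -> \bar R}) (A D : set T) (f : T -> \bar R) (r : R) :
  measurable A -> A `<=` D -> 0 <= r -> (forall x, D x -> 0 <= f x)%E ->
  (forall x, A x -> r%:E <= f x)%E ->
  (r%:E * mu A <= \int[mu]_(x in D) f x)%E.
Proof.
move=> mA AD r0 f0 rf; rewrite ge0_integralE//.
apply: ereal_sup_ubound; exists (scale_nnsfun (indic_nnsfun R mA) r0).
  move=> x; rewrite /= [measurable_realfun.mindic _ _ _]indicE patchE.
  have [xA|xA] := boolP (x \in A).
    by rewrite mulr1 ifT ?rf//; [exact: set_mem | apply/mem_set/AD/set_mem].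
  by rewrite mulr0; case: ifPn => // /set_mem/f0.
have := sintegralrM mu r (indic_nnsfun R mA).
by rewrite sintegral_indic.
Qed.

Lemma quasi_uniformly_continuous_recurrent_segments (R : realType)
    (f : R -> R) (e : R) :
  quasi_uniformly_continuous f \/
    quasi_uniformly_continuous (fun t => - f t) ->
  0 < e -> (forall T : R, exists2 t, T < t & e <= f t) ->
  exists2 d : R, 0 < d & forall T : R, exists2 a, T < a &
    forall t, a <= t <= a + d -> e / 2 <= f t.
Proof.
move=> f_quc e0 fe; have e20 : 0 < e / 2 by lra.
case: f_quc => /(_ _ e20)[d d0 fd]; exists d => // T.
  (* Here [f] rises by less than [e / 2] over a time [d], so the segment ends at [t]. Taking [t]
     beyond [Num.max T 0 + d] puts its left end [t - d] after both [T] and 0, the latter because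
     [fd] speaks of nonnegative times only. *)
  have [t Tt ft] := fe (Num.max T 0 + d).
  have /andP[Ttd td0] : (T < t - d) && (0 < t - d) by rewrite -gt_max; lra.
  exists (t - d) => // u /andP[tdu utd].
  have : f t - f u < e / 2 by apply: fd; lra.
  by lra.
(* Here [f] drops by less than [e / 2] over a time [d], so the segment starts at [t]. *)
have [t] := fe (Num.max T 0); rewrite gt_max => /andP[Tt t0] ft.
exists t => // u /andP[tu utd].
have : - f u - - f t < e / 2 by apply: fd; lra.
by lra.
Qed.

(** By induction on [N]: the bound [M] is carried along so that the next segment can be taken beyond
    it, hence disjoint from the set built so far. *)
Lemma exists_bounded_set_of_measure (R : realType) (P : set R) (d : R) :
  0 < d ->
  (forall T : R, exists2 a, T < a & forall t, a <= t <= a + d -> P t) ->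
  forall N : nat, exists (S : set R) (M : R),
    [/\ measurable S, S `<=` `[0, M], S `<=` P &
        lebesgue_measure S = (N%:R * d)%:E].
Proof.
move=> d0 Pd; elim=> [|N [S [M [mS SM SP muS]]]].
  by exists set0, 0; split => //; rewrite measure0 mul0r.
have [a] := Pd (Num.max M 0); rewrite gt_max => /andP[Ma a0] aP.
exists (S `|` `[a, a + d]), (a + d); split.
- exact: measurableU.
- move=> t [/SM|] /=; rewrite !in_itv /= => /andP[? ?]; apply/andP; split; lra.
- by move=> t [/SP//|] /=; rewrite in_itv /= => /aP.
- rewrite measureU//.
    rewrite [X in X + _]muS [X in _ + X]lebesgue_measure_itv /= lte_fin ltrDl d0.
    by rewrite -EFinB -EFinD -natr1; congr EFin; lra.
  apply/seteqP; split => // t [/SM] /=; rewrite !in_itv /=.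
  by move=> /andP[_ tM] /andP[at_ _]; lra.
Qed.

(** If [rho] is monotone, [c = rho e] works. If [f] is bounded, its values above [e] lie in a
    compact segment of positive reals, on which [rho] attains a positive minimum. *)
Lemma positive_definite_lower_bound (R : realType) (rho f : R -> R) (e : R) :
  {within `[0, +oo[, continuous rho} -> positive_definite rho ->
  {in `[0, +oo[ &, {homo rho : x y / x <= y}} \/
    [bounded f t | t in `[0, +oo[] ->
  0 < e ->
  exists2 c : R, 0 < c & forall t, 0 <= t -> e <= f t -> c <= rho (f t).
Proof.
move=> rho_cont [_ rho_gt0] [rho_mono|f_bounded] e0.
  exists (rho e) => [|t t0 eft]; first exact: rho_gt0.
  by apply: rho_mono => //; rewrite in_itv /= andbT; lra.
have [M M0 fM] := ex_strict_bound_gt0 f_bounded.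
(* The maximum keeps the segment nonempty even when [M < e]. *)
have eM : e <= Num.max e M by rewrite le_max lexx.
have [|x] := @EVT_min _ rho _ _ eM.
  apply: continuous_subspaceW rho_cont => t /=; rewrite !in_itv /= => /andP[? _].
  by rewrite andbT; lra.
rewrite in_itv /= => /andP[ex _] rho_min; exists (rho x).
  by apply: rho_gt0; lra.
move=> t t0 eft; apply: rho_min; rewrite in_itv /= eft /= le_max.
apply/orP; right; apply: le_trans (ler_norm _) _; apply: ltW.
by apply: fM; rewrite /= in_itv /= t0.
Qed.

Theorem lemma3 (R : realType) (rho f : R -> R)
  (rho_nonneg : maps_nonneg rho)
  (rho_cont : {within `[0, +oo[, continuous rho})
  (rho_pd : positive_definite rho)
  (f_nonneg : maps_nonneg f)
  (f_quc : quasi_uniformly_continuous f \/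
           quasi_uniformly_continuous (fun t => - f t))
  (int_fin :
     (\int[@lebesgue_measure R]_(t in `[0%R, +oo[) (rho (f t))%:E < +oo)%E)
  (rho_mono_or_f_bounded :
     {in `[0, +oo[ &, {homo rho : x y / x <= y}} \/
     [bounded f t | t in `[0, +oo[]) :
  f t @[t --> +oo] --> 0.
Proof.
apply/cvgr0Pnorm_lt => e e0; apply: contrapT => f_not_small.
have f_large T : exists2 t, T < t & e <= f t.
  apply: contrapT => f_small; apply: f_not_small.
  exists (Num.max T 0); split; first exact: num_real.
  move=> t; rewrite gt_max => /andP[Tt t0].
  rewrite ger0_norm ?f_nonneg ?ltW// ltNge; apply/negP => eft.
  by apply: f_small; exists t.
have [d d0 f_segments] :=
  quasi_uniformly_continuous_recurrent_segments f_quc e0 f_large.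
have [|c c0 rho_ge] := positive_definite_lower_bound rho_cont rho_pd
  rho_mono_or_f_bounded (e := e / 2); first by lra.
set I := (\int[_]_(_ in _) _)%E in int_fin.
have I_ge N : ((c * (N%:R * d))%:E <= I)%E.
  have [S [M [mS SM Sf muS]]] :=
    exists_bounded_set_of_measure (P := fun t => e / 2 <= f t) d0 f_segments N.
  rewrite EFinM -muS; apply: mule_measure_le_integral => //.
  - by move=> t /SM /=; rewrite !in_itv /= andbT => /andP[].
  - exact: ltW.
  - move=> t /=; rewrite in_itv /= andbT => t0.
    by rewrite lee_fin rho_nonneg// f_nonneg.
  - move=> t St; rewrite lee_fin; apply: rho_ge (Sf _ St).
    by have /= := SM _ St; rewrite in_itv /= => /andP[].
(* The case [N = 0] of [I_ge] gives [0 <= I], which excludes [-oo]. *)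
have I_fin : I \is a fin_num.
  by rewrite fin_numElt int_fin andbT (lt_le_trans _ (I_ge 0%N))// ltNyr.
(* This [N] exceeds [I / (c * d)], so that [c * (N * d) > I], a contradiction. *)
have := I_ge (Num.truncn (fine I / (c * d))).+1.
apply/negP; rewrite -ltNge -(fineK I_fin) lte_fin mulrCA -ltr_pdivrMr ?mulr_gt0//.
exact: truncnS_gt.
Qed.
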